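(* Let $G$ be a compact topological group and let $X$ be a transitive distributive binary $G$-space. Then there exists a normal subgroup $H$ of $G$ such that $X$ is biequimorphic to the binary $G$-space $(G, G|H, \mu)$, where $G|H$ is the coset space and the binary action $\mu : G\times G|H\times G|H\to G|H$ is given by $$\mu(g, g_1H, g_2H) = g_1 g g_1^{-1} g_2 H \qquad \text{for all } g, g_1, g_2\in G.$$
   Context: All maps are assumed continuous. A binary action of a topological group $G$ on a topological space $X$ is a continuous map $\mu : G\times X\times X\to X$, written $\mu(g,x,y)=g(x,y)$, such that $gh(x,y)=g(x,h(x,y))$ and $e(x,y)=y$ for all $g,h\in G$, $x,y\in X$, where $e$ is the identity of $G$. The triple $(G,X,\mu)$ (or just $X$) is then called a binary $G$-space. A binary $G$-space $X$ is distributive if $g(h(x,x'),h(x,x''))=h(x,g(x',x''))$ for all $x,x',x''\in X$ and $g,h\in G$. For $x\in X$ put $G(x,x)=\{g(x,x) : g\in G\}$. A subset $A\subset X$ is bi-invariant if $G(A,A)=\{g(a_1,a_2): g\in G,\ a_1,a_2\in A\}$ equals $A$; the orbit $[x]$ of $x \in X$ is the minimal bi-invariant subset of $X$ containing $x$. A binary $G$-space $X$ is transitive if $G(x,x)=X$ for every $x\in X$, i.e. there is precisely one orbit, $X$ itself (in particular $X$ is nonempty). A continuous map $\varphi : X\to Y$ between binary $G$-spaces is biequivariant if $\varphi(g(x,x'))=g(\varphi(x),\varphi(x'))$ for all $g\in G$, $x,x'\in X$. A biequimorphism is a biequivariant homeomorphism with biequivariant inverse; two binary $G$-spaces are biequimorphic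 if there is a biequimorphism between them. $G|H$ denotes the space of cosets $gH$ with the quotient topology.
   Formalization: The space X is additionally assumed to be T0; without a separation axiom the claim fails, e.g. for G = Z/2 discrete acting on X = Z/2 indiscrete by g(x,y) = g + y, where every coset space G|H is discrete. *)

(* Defs.v *)
From HB Require Import structures.
From mathcomp Require Import all_boot.
From mathcomp Require Import all_classical.
From mathcomp Require Import topology.

Set Implicit Arguments.
Unset Strict Implicit.
Unset Printing Implicit Defensive.

Local Open Scope classical_set_scope.
Local Open Scope group_scope.

HB.mixin Record Group_hasContinuousOps G of Topological G & Group G := {
  mulg_continuous : continuous (fun p : G * G => p.1 * p.2);
  invg_continuous : continuous (fun x : G => x^-1)
}.

#[short(type="topologicalGroupType")]
HB.structure Definition TopologicalGroup :=
  {G of Topological G & Group G & Group_hasContinuousOps G}.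

Record binary_action (G : topologicalGroupType) (X : topologicalType) :=
  BinaryAction {
    bact :> G -> X -> X -> X;
    bact_continuous : continuous (fun p : G * X * X => bact p.1.1 p.1.2 p.2);
    bactM : forall (g h : G) (x y : X), bact (g * h) x y = bact g x (bact h x y);
    bact1 : forall x y : X, bact 1 x y = y
  }.

Definition bi_distributive (G : topologicalGroupType) (X : topologicalType)
    (mu : binary_action G X) : Prop :=
  forall (g h : G) (x x' x'' : X),
    mu g (mu h x x') (mu h x x'') = mu h x (mu g x' x'').

(* There is precisely one orbit, so the empty space is not transitive. *)
Definition bi_transitive (G : topologicalGroupType) (X : topologicalType)
    (mu : binary_action G X) : Prop :=
  inhabited X /\ forall x : X, range (fun g : G => mu g x x) = [set: X].

Definition biequivariant (G : topologicalGroupType) (X Y : topologicalType)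
    (mu : binary_action G X) (nu : binary_action G Y) (f : X -> Y) : Prop :=
  continuous f /\
  forall (g : G) (x x' : X), f (mu g x x') = nu g (f x) (f x').

Definition biequimorphic (G : topologicalGroupType) (X Y : topologicalType)
    (mu : binary_action G X) (nu : binary_action G Y) : Prop :=
  exists (f : X -> Y) (f' : Y -> X),
    [/\ cancel f f', cancel f' f,
        biequivariant mu nu f & biequivariant nu mu f'].

(* Subgroups of a possibly infinite group are elements of [groupClosed G]. *)
Definition normal_subgroup (G : groupType) (H : groupClosed G) : Prop :=
  forall g h : G, h \in H -> g * h * g^-1 \in H.

Definition same_lcoset (G : groupType) (H : groupClosed G) : rel G :=
  fun x y => x^-1 * y \in H.

Lemma same_lcoset_equiv (G : groupType) (H : groupClosed G) :
  equiv_class_of (same_lcoset H).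
Proof.
split=> [x|x y|y x z]; rewrite /same_lcoset.
- by rewrite mulVg gpred1.
- by rewrite -gpredV invgM invgK.
- move=> xy yz.
  by rewrite -[z](mulVKg y) mulgA gpredM.
Qed.

Canonical same_lcoset_equiv_rel (G : groupType) (H : groupClosed G) :=
  EquivRelPack (same_lcoset_equiv H).

(* G|H: [coset_space H] is G modulo [x^-1 * y \in H], i.e. xH = yH. *)
Definition coset_space (G : topologicalGroupType) (H : groupClosed G) :
    topologicalType :=
  quotient_topology {eq_quot same_lcoset H}%qT.

Definition lcoset_of (G : topologicalGroupType) (H : groupClosed G) (g : G) :
    coset_space H :=
  (\pi_(quotient_topology {eq_quot same_lcoset H}) g)%qT.

(* Main.v *)
Require Import Defs.
From HB Require Import structures.
From mathcomp Require Import all_boot.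
From mathcomp Require Import all_classical.
From mathcomp Require Import topology.

Set Implicit Arguments.
Unset Strict Implicit.
Unset Printing Implicit Defensive.

Local Open Scope classical_set_scope.
Local Open Scope group_scope.

(** Fix a point a of X and consider the orbit map phi g = g(a,a), which
    transitivity makes surjective.  Distributivity applied to
    g2(a,a) = g1(a, g1^-1 g2 (a,a)) gives ([bact_distr_orbit])
      g(phi g1, phi g2) = phi (g1 g g1^-1 g2),
    so the stabilizer H of a under the ordinary action g.y = g(a,y) determines
    the whole binary action: phi induces a bijection from G|H onto X that
    carries the announced formula to the given action.  For h in H the point
    phi h is a, and the left-hand side does not see the difference between
    g1 = h and g1 = 1; comparing the two right-hand sides shows that H is
    normal ([bi_stab_normal]).

    What remains is topological: the continuous bijection G|H -> X must be a
    homeomorphism, although X is only supposed to be T0 and G need not be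
    Hausdorff.  It suffices that phi be a closed map.  When {a} is closed, the
    image of a closed F is the projection to X of the closed set of the pairs
    (g, y) with g in F and g^-1(a,y) = a, and projecting along the compact
    space G preserves closedness ([orbit_map_closed]).  That {a} is closed
    ([orbit_point_closed]) comes from compactness again: the g that send a into
    the closure of {a} form a closed semigroup, and a closed semigroup in a
    compact group is stable under inverses
    ([compact_group_closed_semigroupV]).  Hence any y in the closure of {a} has
    a in its own closure, and y = a by the T0 axiom. *)

(** A tube argument: off the projection of A, each slice K x {x} misses the
    closed set A, hence so does a whole tube around it, K being compact. *)
Lemma compact_closed_snd (K X : topologicalType) (A : set (K * X)) :
  compact [set: K] -> closed A -> closed (snd @` A).
Proof.
move=> cK cA; rewrite closedE => x nAx; apply: contrapT => xNA; apply: nAx.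
have cov : forall k : K, [set: K] k ->
    \forall k' \near k & x' \near x, ~ A (k', x').
  move=> k _; have oA : open (~` A) by rewrite openC.
  have : nbhs (k, x) (~` A).
    by apply: open_nbhs_nbhs; split=> // Akx; apply: xNA; exists (k, x).
  by apply: filterS => -[].
have /compact_near_coveringP/(_ _ _ (fun x k => ~ A (k, x)) _ cov) := cK.
by apply: filterS => y yNA [[k z] /= Akz zy]; apply: (yNA k); rewrite -?zy.
Qed.

(** The powers of g accumulate at some c, so two of them, g^m and g^n with
    m + 1 < n, are both close to c; then g^(n-m-1) is close to g^-1. *)
Lemma compact_group_closed_semigroupV (G : topologicalGroupType) (S : set G)
    (g : G) :
  compact [set: G] -> closed S -> (forall x y, S x -> S y -> S (x * y)) ->
  S g -> S g^-1.
Proof.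
move=> cG cS SM Sg.
have SX n : S (g ^+ n.+1) by elim: n => [//|n IHn]; rewrite expgS; exact: SM.
have [c [_ clc]] := cG ((fun n => g ^+ n) @ \oo) _ filterT.
have /closure_id -> := cS => U Ugi.
have quo : (fun p : G * G => g^-1 * (p.1^-1 * p.2)) @ (c, c) --> g^-1.
  rewrite -[X in _ --> X]mulg1 -[X in g^-1 * X](mulVg c).
  apply: (@continuous2_cvg _ _ _ _ _ _ (fun=> g^-1)
            (fun p : G * G => p.1^-1 * p.2) (fun x y : G => x * y)).
  - exact: (mulg_continuous (g^-1, c^-1 * c)).
  - exact: cvg_cst.
  - apply: (@continuous2_cvg _ _ _ _ _ _ (fun p : G * G => p.1^-1) snd
            (fun x y : G => x * y)).
    + exact: (mulg_continuous (c^-1, c)).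
    + apply: (@cvg_comp _ _ _ fst (fun x : G => x^-1)); first exact: cvg_fst.
      exact: invg_continuous.
    + exact: cvg_snd.
have [[W1 W2] /= [W1c W2c] WU] := quo _ Ugi.
have [_ [[m _ <-] W1m]] := clc (range (fun n => g ^+ n)) _
  (filterE _ (fun n => ex_intro2 _ _ n I erefl)) W1c.
have [_ [[n /= mn <-] W2n]] :
    [set g ^+ n | n in [set n | (m.+1 < n)%N]] `&` W2 !=set0.
  apply: clc W2c; apply: (@filterS _ \oo _ [set n | (m.+1 < n)%N]);
    last exact: nbhs_infty_gt.
  by move=> n mn; exists n.
(* Taking n > m + 1 keeps the exponent n - m - 1 positive, which matters because
   S is not known to contain 1. *)
exists (g ^+ (n - m.+2).+1); split; first exact: SX.
have gnE : g ^+ n = g ^+ m * (g * g ^+ (n - m.+2).+1).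
  by rewrite -expgS -expgnDr -[in LHS](subnKC mn) !addSn !addnS.
by have := WU (g ^+ m, g ^+ n) (conj W1m W2n); rewrite /preimage /= gnE !mulKg.
Qed.

Section Action.
Context (G : topologicalGroupType) (X : topologicalType).
Variable mu : binary_action G X.

Lemma bact_comp_continuous (T : topologicalType) (u : T -> G) (v w : T -> X) :
  continuous u -> continuous v -> continuous w ->
  continuous (fun t => mu (u t) (v t) (w t)).
Proof.
move=> cu cv cw t.
have cvu : (u t', v t') @[t' --> t] --> (u t, v t).
  exact: (cvg_pair (cu t) (cv t)).
have cvuw : (u t', v t', w t') @[t' --> t] --> (u t, v t, w t).
  exact: (cvg_pair cvu (cw t)).
exact: (cvg_comp _ _ cvuw (@bact_continuous _ _ mu (u t, v t, w t))).
Qed.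

Lemma orbit_map_continuous a : continuous (fun g => mu g a a).
Proof.
apply: bact_comp_continuous => g; [exact: cvg_id|exact: cst_continuous|].
exact: cst_continuous.
Qed.

Lemma bact_continuousr g x : continuous (mu g x).
Proof.
apply: bact_comp_continuous => y; [exact: cst_continuous| |exact: cvg_id].
exact: cst_continuous.
Qed.

Lemma bactK g x y : mu g^-1 x (mu g x y) = y.
Proof. by rewrite -bactM mulVg bact1. Qed.

Lemma bactVK g x y : mu g x (mu g^-1 x y) = y.
Proof. by rewrite -bactM mulgV bact1. Qed.

(** The stabilizer of a for the action of G on X with first argument a. *)
Definition bi_stab (a : X) : {pred G} := fun g => `[< mu g a a = a >].

Lemma in_bi_stab a g : (g \in bi_stab a) <-> mu g a a = a.
Proof. by split=> /asboolP. Qed.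

Lemma bi_stab1 a : 1 \in bi_stab a.
Proof. by apply/in_bi_stab; rewrite bact1. Qed.

Lemma bi_stabM a : mulg_closed (bi_stab a).
Proof.
move=> g h /in_bi_stab ga /in_bi_stab ha.
by apply/in_bi_stab; rewrite bactM ha.
Qed.

Lemma bi_stabV a : invg_closed (bi_stab a).
Proof. by move=> g /in_bi_stab ga; apply/in_bi_stab; rewrite -{2}ga bactK. Qed.

HB.instance Definition _ a := isMulClosed.Build G (bi_stab a) (@bi_stabM a).
HB.instance Definition _ a := isMul1Closed.Build G (bi_stab a) (bi_stab1 a).
HB.instance Definition _ a := isInvClosed.Build G (bi_stab a) (@bi_stabV a).

Lemma bact_eq_stab a g h :
  mu g a a = mu h a a <-> g^-1 * h \in bi_stab a.
Proof.
rewrite in_bi_stab bactM; split=> [<-|e]; first by rewrite bactK.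
by rewrite -(bactVK g a (mu h a a)) e.
Qed.

Lemma bact_distr_orbit a g g1 g2 : bi_distributive mu ->
  mu g (mu g1 a a) (mu g2 a a) = mu (g1 * g * g1^-1 * g2) a a.
Proof. by move=> mud; rewrite -{1}(bactVK g1 a (mu g2 a a)) mud !bactM. Qed.

(** For h in H both h(a,a) and h^-1(a,a) are a, so the orbit formula for
    g^-1(h(a,a), a) reads g^-1(a,a) = h g^-1 (a,a); apply g to both sides. *)
Lemma bi_stab_normal a : bi_distributive mu -> normal_subgroup (bi_stab a).
Proof.
move=> mud g h hH; apply/in_bi_stab.
have /in_bi_stab hVa : h^-1 \in bi_stab a by rewrite gpredV.
have := bact_distr_orbit a g^-1 h 1 mud.
move/in_bi_stab: hH => ha; rewrite ha bact1 mulg1 !bactM hVa => <-.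
exact: bactVK.
Qed.

(** Moving a into its own closure can be undone inside that closure, so a and
    any point y of its closure belong to each other's closures. *)
Lemma orbit_point_closed a : compact [set: G] -> kolmogorov_space X ->
  range (fun g => mu g a a) = [set: X] -> closed [set a].
Proof.
move=> cG T0 tr.
pose S := [set g | closure [set a] (mu g a a)].
have cS : closed S.
  apply: preimage_closed; last exact: closed_closure.
  by move=> g _; exact: orbit_map_continuous.
have clM g x y : closure [set x] y -> closure [set mu g a x] (mu g a y).
  move=> xy B By.
  by have [_ [-> Bx]] := xy _ (@bact_continuousr g a y _ By); exists (mu g a x).
have SM g h : S g -> S h -> S (g * h).
  rewrite /S/= bactM => Sg /(clM g).
  have /closure_id -> := @closed_closure _ [set a].
  by apply: closureS => _ ->.
apply/closure_id; apply/seteqP; split; first exact: subset_closure.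
move=> y ay; have [g _ gay] : range (fun g => mu g a a) y by rewrite tr.
have Sg : S g by rewrite /S/= gay.
have ya : closure [set y] a.
  have := compact_group_closed_semigroupV cG cS SM Sg.
  by move=> /(clM g); rewrite bactVK gay.
apply/eqP/negPn/negP => /T0 [A [] []]; rewrite !inE.
- by move=> /ay [_ [->]].
- by move=> /ya [_ [->]].
Qed.

(** The image of F is the set of the y that some g^-1 with g in F brings
    back to a: a projection along the compact space G. *)
Lemma orbit_map_closed a (F : set G) : compact [set: G] -> closed [set a] ->
  closed F -> closed ((fun g => mu g a a) @` F).
Proof.
move=> cG ca cF.
have -> : (fun g => mu g a a) @` F =
    snd @` ((fst : G * X -> G) @^-1` F `&`
            (fun p : G * X => mu p.1^-1 a p.2) @^-1` [set a]).
  apply/seteqP; split=> [_ [g Fg <-]|_ [[g x] /= [Fg ga] <-]].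
    by exists (g, mu g a a) => //=; rewrite bactK.
  by exists g => //; rewrite -[RHS](bactVK g a) ga.
apply: compact_closed_snd => //; apply: closedI.
  by apply: preimage_closed => // p _; exact: cvg_fst.
apply: preimage_closed => // p _.
apply: bact_comp_continuous => // q.
- apply: (@cvg_comp _ _ _ fst (fun x : G => x^-1)); first exact: cvg_fst.
  exact: invg_continuous.
- exact: cvg_cst.
- exact: cvg_snd.
Qed.

End Action.

Theorem theorem1 (G : topologicalGroupType) (X : topologicalType)
    (mu : binary_action G X) :
  compact [set: G] ->
  kolmogorov_space X ->
  bi_transitive mu ->
  bi_distributive mu ->
  exists H : groupClosed G,
    normal_subgroup H /\
    exists nu : binary_action G (coset_space H),
      (forall g g1 g2 : G,
         nu g (lcoset_of H g1) (lcoset_of H g2) =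
         lcoset_of H (g1 * g * g1^-1 * g2)) /\
      biequimorphic mu nu.
Proof.
move=> cG T0 [[a] tr] mud.
pose H : groupClosed G := bi_stab mu a.
exists H; split; first exact: bi_stab_normal.
pose phi g := mu g a a.
have cphi : continuous phi by exact: orbit_map_continuous.
have /choice[s phis] x : exists g, phi g = x.
  by have [g _ <-] : range phi x; [rewrite tr | exists g].
have lcosetE g h : lcoset_of H g = lcoset_of H h <-> phi g = phi h.
  rewrite bact_eq_stab; split=> [|gh]; first by move=> /eqmodP.
  exact/eqmodP.
have phi_repr g : phi (repr (lcoset_of H g)) = phi g.
  by apply/lcosetE; rewrite /lcoset_of reprK.
pose f x := lcoset_of H (s x).
pose f' : coset_space H -> X := phi \o repr.
have fphi g : f (phi g) = lcoset_of H g by apply/lcosetE; rewrite phis.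
have fK : cancel f f' by move=> x; rewrite /f' /f /= phi_repr phis.
have f'K : cancel f' f by move=> q; rewrite /f' /= fphi /lcoset_of reprK.
have cf' : continuous f'.
  apply: repr_comp_continuous => // g h /eqP gh; apply/eqP.
  exact/lcosetE.
have cf : continuous f.
  apply/continuous_closedP => C cC.
  (* The preimage of C under the inverse bijection is an image under the
     orbit map, which is closed. *)
  have -> : f @^-1` C = phi @` (lcoset_of H @^-1` C).
    apply/seteqP; split=> [x Cfx|_ [g Cg <-]].
      by exists (s x).
    by rewrite /preimage/= fphi.
  apply: (orbit_map_closed cG (orbit_point_closed cG T0 (tr a))).
  by have /continuous_closedP/(_ C cC) :=
    @pi_continuous _ {eq_quot same_lcoset H}%qT.
(* The action on cosets is transported from X, so that its continuity and its
   axioms come from those of mu; the formula is then the orbit formula. *)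
pose nuf g u v := f (mu g (f' u) (f' v)).
have nu_cont : continuous (fun p : G * coset_space H * coset_space H =>
    nuf p.1.1 p.1.2 p.2).
  suff cmu : continuous (fun p : G * coset_space H * coset_space H =>
      mu p.1.1 (f' p.1.2) (f' p.2)).
    by move=> p; exact: (continuous_comp (cmu p) (cf _)).
  apply: bact_comp_continuous => -[[g u] v].
  - exact: (cvg_comp _ _ cvg_fst cvg_fst).
  - have csnd : p.1.2 @[p --> (g, u, v)] --> u.
      exact: (cvg_comp _ _ cvg_fst cvg_snd).
    exact: (@continuous_comp _ _ _ (fun p => p.1.2) f' (g, u, v) csnd (cf' u)).
  - exact: (@continuous_comp _ _ _ snd f' (g, u, v) cvg_snd (cf' v)).
have nuM g h u v : nuf (g * h) u v = nuf g u (nuf h u v).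
  by rewrite /nuf bactM fK.
have nu1 u v : nuf 1 u v = v by rewrite /nuf bact1 f'K.
exists (BinaryAction nu_cont nuM nu1); split=> [g g1 g2 /=|].
  by rewrite /nuf /f' /= !phi_repr bact_distr_orbit // fphi.
exists f, f'; split=> //; split=> // g u v /=.
- by rewrite /nuf !fK.
- by rewrite /nuf fK.
Qed.
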